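(* Let $M\subset\mathbb{R}^d$ be a free $\mathbb{Z}$-module of finite rank $r$ that spans $\mathbb{R}^d$ (over $\mathbb{R}$). Then the sets $\operatorname{OS}(M)$ and $\operatorname{OC}(M)$ are subgroups of $\operatorname{O}(d,\mathbb{R})$.
   Context: A free $\mathbb{Z}$-module in $\mathbb{R}^d$ means an additive subgroup of $\mathbb{R}^d$ that is free abelian (its rank may exceed $d$). Two free $\mathbb{Z}$-modules $M,M'\subset\mathbb{R}^d$ of finite rank are commensurate, written $M\sim M'$, if $M\cap M'$ has finite index both in $M$ and in $M'$. The set of coincidence isometries of $M$ is $\operatorname{OC}(M)=\{R\in\operatorname{O}(d,\mathbb{R}) : RM\sim M\}$. The set of similarity isometries of $M$ is $\operatorname{OS}(M)=\{R\in\operatorname{O}(d,\mathbb{R}) : \alpha RM\sim M \text{ for some real } \alpha>0\}$. *)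

(* Defs.v *)
From HB Require Import structures.
From mathcomp Require Import all_boot all_order all_algebra.
From mathcomp Require Import boolp classical_sets cardinality reals.

Set Implicit Arguments.
Unset Strict Implicit.
Unset Printing Implicit Defensive.

Import Order.TTheory GRing.Theory Num.Theory.
Local Open Scope classical_set_scope.
Local Open Scope ring_scope.

Section OrthogonalGroup.
Variables (R : realType) (d : nat).

Record orthogonal_matrix := Orthogonal {
  orthogonal_mx :> 'M[R]_d;
  orthogonal_mxP : orthogonal_mx *m orthogonal_mx^T == 1%:M }.

HB.instance Definition _ := [isSub for orthogonal_mx].
HB.instance Definition _ := [Choice of orthogonal_matrix by <:].

Fact orthogonal_one_subproof : (1%:M : 'M[R]_d) *m 1%:M^T == 1%:M.
Proof. by rewrite trmx1 mulmx1. Qed.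

Fact orthogonal_mul_subproof (A B : orthogonal_matrix) :
  (A *m B) *m (A *m B)^T == 1%:M.
Proof.
rewrite trmx_mul mulmxA -(mulmxA A) (eqP (orthogonal_mxP B)) mulmx1.
exact: orthogonal_mxP.
Qed.

Fact orthogonal_inv_subproof (A : orthogonal_matrix) : A^T *m A^T^T == 1%:M.
Proof. by rewrite trmxK (mulmx1C (eqP (orthogonal_mxP A))). Qed.

Definition orthogonal_one := Orthogonal orthogonal_one_subproof.
Definition orthogonal_mul A B := Orthogonal (orthogonal_mul_subproof A B).
Definition orthogonal_inv A := Orthogonal (orthogonal_inv_subproof A).

Fact orthogonal_mulA : associative orthogonal_mul.
Proof. by move=> A B C; apply: val_inj; rewrite /= mulmxA. Qed.

Fact orthogonal_mul1 : left_id orthogonal_one orthogonal_mul.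
Proof. by move=> A; apply: val_inj; rewrite /= mul1mx. Qed.

Fact orthogonal_1mul : right_id orthogonal_one orthogonal_mul.
Proof. by move=> A; apply: val_inj; rewrite /= mulmx1. Qed.

Fact orthogonal_mulV :
  left_inverse orthogonal_one orthogonal_inv orthogonal_mul.
Proof.
by move=> A; apply: val_inj; rewrite /= (mulmx1C (eqP (orthogonal_mxP A))).
Qed.

Fact orthogonal_Vmul :
  right_inverse orthogonal_one orthogonal_inv orthogonal_mul.
Proof. by move=> A; apply: val_inj; rewrite /= (eqP (orthogonal_mxP A)). Qed.

HB.instance Definition _ := isGroup.Build orthogonal_matrix
  orthogonal_mulA orthogonal_mul1 orthogonal_1mul
  orthogonal_mulV orthogonal_Vmul.

End OrthogonalGroup.

Notation "''O[' R ]_ d" := (orthogonal_matrix R d)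
  (at level 8, d at level 2, format "''O[' R ]_ d") : type_scope.

Definition subgroup (G : groupType) (H : set G) : Prop :=
  group_closed [in H].

Section Commensurability.
Variable V : zmodType.

(* The set of left cosets of N by elements of M; when N is a subgroup of the
   group M, its cardinal is the index [M : N]. *)
Definition cosets (N M : set V) : set (set V) :=
  [set [set x + y | y in N] | x in M].

Definition finite_index (N M : set V) : Prop := finite_set (cosets N M).

Definition commensurate (M M' : set V) : Prop :=
  finite_index (M `&` M') M /\ finite_index (M `&` M') M'.

Definition free_zmodule (r : nat) (M : set V) : Prop :=
  zmod_closed [in M] /\
  exists b : 'I_r -> V,
    (forall a : 'I_r -> int, \sum_i b i *~ a i = 0 -> forall i, a i = 0) /\
    M = [set \sum_i b i *~ a i | a in [set: 'I_r -> int]].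

End Commensurability.

Section Isometries.
Variables (R : realType) (d : nat).
Implicit Type M : set 'cV[R]_d.

Definition spans M : Prop :=
  forall v : 'cV[R]_d, exists (n : nat) (c : 'I_n -> R) (x : 'I_n -> 'cV[R]_d),
    (forall i, M (x i)) /\ v = \sum_i c i *: x i.

(* Coincidence isometries (OC) and similarity isometries (OS); the linear maps
   act on column vectors. *)
Definition OC M : set 'O[R]_d :=
  [set A : 'O[R]_d | commensurate [set A *m x | x in M] M].

Definition OS M : set 'O[R]_d :=
  [set A : 'O[R]_d | exists2 alpha : R, 0 < alpha &
     commensurate [set alpha *: (A *m x) | x in M] M].

End Isometries.

(* Main.v *)
Require Import Defs.
From mathcomp Require Import all_boot all_order all_algebra.
From mathcomp Require Import boolp classical_sets cardinality reals.

(** Both sets are subgroups because commensurability is an equivalence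
relation on the additive subgroups of [V] that is preserved by every injective
additive map.

If [a A M ~ M] and [b B M ~ M], apply the similarity [(a / b) A B^-1] to the
relation [M ~ b B M]; this gives [(a / b) A B^-1 M ~ a A M], and [a A M ~ M],
so [(a / b) A B^-1] is again in the set by transitivity.  Taking [a = b = 1]
gives the same closure property for [OC M].  The identity belongs to both sets
by reflexivity.

The substance is transitivity.  It is obtained by reading [finite_index N M]
as the existence of a colouring of [M] by finitely many colours in which
elements of equal colour are congruent modulo [N] ([finite_indexP]).  Given
such colourings for [M1 `&` M2] in [M1] and for [M2 `&` M3] in [M2], an element
of [M1] is coloured by its first colour together with the second colour of its
difference from a representative of its first colour class, a difference that
lies in [M2]. *)

Import Order.TTheory GRing.Theory Num.Theory.

Local Open Scope classical_set_scope.
Local Open Scope ring_scope.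

Section Commensurability.
Context {V : zmodType}.
Implicit Types L M N : set V.

Lemma zmod_closed_set M :
  zmod_closed [in M] <-> M 0 /\ (forall x y, M x -> M y -> M (x - y)).
Proof.
split=> [[M0 MB]|[M0 MB]]; split.
- by move: M0; rewrite inE.
- by move=> x y Mx My; have := MB x y; rewrite !inE; apply.
- by rewrite inE.
- by move=> x y; rewrite !inE; apply: MB.
Qed.

Lemma zmod_closedI M N :
  zmod_closed [in M] -> zmod_closed [in N] -> zmod_closed [in M `&` N].
Proof.
move=> /zmod_closed_set[M0 MB] /zmod_closed_set[N0 NB].
apply/zmod_closed_set; split=> // x y [Mx Nx] [My Ny].
by split; [apply: MB | apply: NB].
Qed.

Lemma coset_congr N x y : zmod_closed [in N] ->
  [set x + z | z in N] = [set y + z | z in N] <-> N (x - y).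
Proof.
move=> /zmod_closed_set[N0 NB]; split=> [xy|Nxy].
  have : [set x + z | z in N] x by exists 0 => //; rewrite addr0.
  by rewrite xy => -[z Nz <-]; rewrite addrAC subrr add0r.
have Nyx : N (y - x) by rewrite -opprB -[- _]sub0r; apply: NB.
have sub u v : N (v - u) -> [set u + z | z in N] `<=` [set v + z | z in N].
  move=> Nvu _ [z Nz <-]; exists (z - (v - u)); first exact: NB.
  by rewrite addrC -addrA opprB subrK addrC.
by apply/seteqP; split; apply: sub.
Qed.

(** Cosets are awkward to combine when three groups are involved; a colouring
only needs its values to determine classes, so that refining one amounts to
pairing colours, and colours are allowed to split a coset. *)
Lemma finite_indexP N M : zmod_closed [in N] ->
  finite_index N M <->
  exists (T : Type) (c : V -> T), finite_set (c @` M) /\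
    forall x y, M x -> M y -> c x = c y -> N (x - y).
Proof.
move=> Nz; split=> [fin|[T [c [fin cN]]]].
  exists (set V), (fun x => [set x + z | z in N]); split=> // x y _ _.
  by move=> /(coset_congr _ _ _ Nz).
pose rep t := xget 0 [set x | M x /\ c x = t].
apply: (@sub_finite_set _ _ ((fun t => [set rep t + z | z in N]) @` (c @` M)));
  last exact: finite_image.
move=> _ [x Mx <-]; exists (c x); first by exists x.
have [Mr cr] : M (rep (c x)) /\ c (rep (c x)) = c x.
  by apply: (@xgetPex _ 0 [set y | M y /\ c y = c x]); exists x.
by apply/(coset_congr _ _ _ Nz)/cN.
Qed.

Lemma finite_index_refl M : zmod_closed [in M] -> finite_index M M.
Proof.
move=> Mz; apply/(finite_indexP _ _ Mz); have /zmod_closed_set[_ MB] := Mz.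
exists unit, (fun=> tt); split=> [|x y Mx My _]; last exact: MB.
by apply: (sub_finite_set _ (finite_set1 tt)) => -[].
Qed.

Lemma finite_index_image (W : zmodType) (f : {additive V -> W}) N M :
  finite_index N M -> finite_index (f @` N) (f @` M).
Proof.
move=> /(finite_image (image^~ f)); apply: sub_finite_set.
move=> _ [_ [x Mx <-] <-]; exists [set x + z | z in N]; first by exists x.
by rewrite !image_comp; apply: eq_imagel => z _ /=; rewrite raddfD.
Qed.

Lemma image_setI_inj (T U : Type) (f : T -> U) (A B : set T) :
  injective f -> f @` (A `&` B) = f @` A `&` f @` B.
Proof.
move=> f_inj; apply/seteqP; split; first exact: sub_image_setI.
by move=> _ [[x Ax <-] [y By /f_inj yx]]; exists x => //; split; rewrite // -yx.
Qed.

Lemma commensurate_refl M : zmod_closed [in M] -> commensurate M M.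
Proof.
by move=> Mz; rewrite /commensurate setIid; split; apply: finite_index_refl.
Qed.

Lemma commensurate_sym M N : commensurate M N -> commensurate N M.
Proof. by rewrite /commensurate setIC => -[]. Qed.

(** Elements of [L] of equal pair colour share a representative [w], chosen in
[L] itself so that their differences from [w] lie in [L `&` M]; these
differences have the same colour in [M] and are therefore congruent modulo
[M `&` N]. *)
Lemma finite_index_setI_trans L M N :
  zmod_closed [in L] -> zmod_closed [in M] -> zmod_closed [in N] ->
  finite_index (L `&` M) L -> finite_index (M `&` N) M ->
  finite_index (L `&` N) L.
Proof.
move=> Lz Mz Nz.
move=> /(finite_indexP _ _ (zmod_closedI _ _ Lz Mz))[T [c [finc cP]]].
move=> /(finite_indexP _ _ (zmod_closedI _ _ Mz Nz))[U [e [fine eP]]].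
apply/(finite_indexP _ _ (zmod_closedI _ _ Lz Nz)).
have /zmod_closed_set[_ LB] := Lz.
pose rep t := xget 0 [set x | L x /\ c x = t].
have repP x : L x -> L (rep (c x)) /\ c (rep (c x)) = c x.
  by move=> Lx; apply: (@xgetPex _ 0 [set y | L y /\ c y = c x]); exists x.
have Mrep x : L x -> M (x - rep (c x)).
  by move=> Lx; have [Lr cr] := repP x Lx; have [] := cP _ _ Lx Lr (esym cr).
exists (T * U)%type, (fun x => (c x, e (x - rep (c x)))); split.
  apply: sub_finite_set (finite_setX finc fine) => _ [x Lx <-].
  by split=> /=; [exists x | exists (x - rep (c x)) => //; apply: Mrep].
move=> x y Lx Ly [cxy exy]; split; first exact: LB.
have [_] := eP _ _ (Mrep x Lx) (Mrep y Ly) exy.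
by rewrite cxy opprB addrA subrK.
Qed.

Lemma commensurate_trans L M N :
  zmod_closed [in L] -> zmod_closed [in M] -> zmod_closed [in N] ->
  commensurate L M -> commensurate M N -> commensurate L N.
Proof.
move=> Lz Mz Nz [LM ML] [MN NM]; split.
  exact: (finite_index_setI_trans _ M).
by rewrite setIC; apply: (finite_index_setI_trans _ M); rewrite // setIC.
Qed.

End Commensurability.

Lemma zmod_closed_image (V W : zmodType) (f : {additive V -> W}) (M : set V) :
  zmod_closed [in M] -> zmod_closed [in f @` M].
Proof.
move=> /zmod_closed_set[M0 MB]; apply/zmod_closed_set; split.
  by exists 0; rewrite ?raddf0.
move=> _ _ [x Mx <-] [y My <-]; exists (x - y); last by rewrite raddfB.
exact: MB.
Qed.

Lemma commensurate_image (V W : zmodType) (f : {additive V -> W})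
    (M N : set V) :
  injective f -> commensurate M N -> commensurate (f @` M) (f @` N).
Proof.
move=> f_inj [MN NM]; rewrite /commensurate -image_setI_inj //.
by split; apply: finite_index_image.
Qed.

(** With [P = B *m invmx C], this is closure under division of the set of
invertible matrices that map [M] to a commensurate group: [P] carries
[C M ~ M] to [B M ~ P M]. *)
Lemma commensurate_mulmx_div (R : comUnitRingType) (d : nat)
    (M : set 'cV[R]_d) (P B C : 'M[R]_d) :
  zmod_closed [in M] -> P \in unitmx -> P *m C = B ->
  commensurate (mulmx B @` M) M -> commensurate (mulmx C @` M) M ->
  commensurate (mulmx P @` M) M.
Proof.
move=> Mz Pu PC BM CM; have imz A : zmod_closed [in mulmx A @` M].
  exact: (zmod_closed_image _ _ (mulmx A)).
apply: (commensurate_trans _ (mulmx B @` M)) => //.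
apply: commensurate_sym; rewrite -PC.
have -> : mulmx (P *m C) @` M = mulmx P @` (mulmx C @` M).
  by rewrite image_comp; apply: eq_imagel => x _ /=; rewrite mulmxA.
apply: (commensurate_image _ _ (mulmx P)) => //.
exact: can_inj (mulKmx Pu).
Qed.

Section Isometries.
Context {R : realType} {d : nat}.
Implicit Types (M : set 'cV[R]_d) (A B : 'O[R]_d).

(** Absorbing the scalar into the matrix turns similarities and isometries alike
into multiplication by an invertible matrix. *)
Lemma OS_mulmx M A :
  OS M A <->
  exists2 a : R, 0 < a & commensurate (mulmx (a *: (A : 'M_d)) @` M) M.
Proof.
have E a : [set a *: (A *m x) | x in M] = mulmx (a *: (A : 'M_d)) @` M.
  by apply: eq_imagel => x _; rewrite scalemxAl.
by split=> -[a a0 aM]; exists a => //=; [rewrite -E | rewrite E].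
Qed.

Lemma orthogonal_unitmx A : (A : 'M_d) \in unitmx.
Proof. by have /eqP/mulmx1_unit[] := orthogonal_mxP A. Qed.

Lemma orthogonal_divK A B : (A / B)%g *m B = A :> 'M_d.
Proof. by rewrite -[in RHS](divgK B A). Qed.

Lemma subgroup_OC M : zmod_closed [in M] -> subgroup (OC M).
Proof.
move=> Mz; split=> [|A B]; rewrite !inE.
  have M1 : [set (1%g : 'O[R]_d) *m x | x in M] = M.
    by rewrite -[RHS]image_id; apply: eq_imagel => x _; rewrite mul1mx.
  by rewrite /OC /mkset M1; apply: commensurate_refl.
apply: commensurate_mulmx_div => //.
  exact: orthogonal_unitmx.
exact: orthogonal_divK.
Qed.

Lemma subgroup_OS M : zmod_closed [in M] -> subgroup (OS M).
Proof.
move=> Mz; split=> [|A B]; rewrite !inE.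
  apply/OS_mulmx; exists 1 => //; rewrite scale1r.
  by have [] := subgroup_OC M Mz; rewrite inE.
move=> /OS_mulmx[a a0 aM] /OS_mulmx[b b0 bM].
apply/OS_mulmx; exists (a / b); first exact: divr_gt0.
apply: commensurate_mulmx_div aM bM => //.
  by rewrite unitmxZ ?orthogonal_unitmx // unitfE gt_eqF // divr_gt0.
by rewrite -scalemxAl -scalemxAr scalerA orthogonal_divK divfK // gt_eqF.
Qed.

End Isometries.

Theorem lemma2p5 (R : realType) (d r : nat) (M : set 'cV[R]_d)
    (hfree : free_zmodule r M) (hspan : spans M) :
  subgroup (OS M) /\ subgroup (OC M).
Proof.
by have [Mz _] := hfree; split; [apply: subgroup_OS | apply: subgroup_OC].
Qed.
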